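(* Let $G$ be a finite group and let $V$ be a finite-dimensional $G$-module over $\mathbb{C}$. Let $A=(a_{\nu,\lambda})_{\nu,\lambda\in\Lambda(G)}$ be the adjacency matrix of the McKay quiver of $(G,V)$. Then for all $\nu,\lambda\in\Lambda(G)$ and all integers $k\ge 0$, the number of walks of $k$ steps from node $\nu$ to node $\lambda$ on the McKay quiver is $$(A^k)_{\nu,\lambda}=|G|^{-1}\sum_{\mu\in\Lambda(G)}|\mathcal{C}_\mu|\,\chi_\nu(c_\mu)\,\chi_V(c_\mu)^k\,\overline{\chi_\lambda(c_\mu)}=|G|^{-1}\sum_{g\in G}\chi_\nu(g)\,\chi_V(g)^k\,\overline{\chi_\lambda(g)}.$$
   Context: $\Lambda(G)$ is a finite set indexing the irreducible complex representations of $G$ up to isomorphism, and (since the numbers agree) also the conjugacy classes of $G$. For $\lambda\in\Lambda(G)$, $G_\lambda$ is the corresponding irreducible $G$-module and $\chi_\lambda$ its character; $\chi_V$ is the character of $V$. For $\mu\in\Lambda(G)$, $c_\mu$ is a fixed representative of the conjugacy class $\mathcal{C}_\mu$ labeled by $\mu$. The McKay quiver of $(G,V)$ is the directed multigraph with node set $\Lambda(G)$ having $a_{\nu,\lambda}$ arrows from $\nu$ to $\lambda$, where $a_{\nu,\lambda}$ is the multiplicity of $G_\lambda$ in $G_\nu\otimes V$. *)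

(* Defs.v *)
From HB Require Import structures.
From mathcomp Require Import all_boot all_order all_fingroup all_algebra.
From mathcomp Require Import mxrepresentation character.
From mathcomp Require Import boolp reals complex.

Set Implicit Arguments.
Unset Strict Implicit.
Unset Printing Implicit Defensive.

Import GRing.Theory Num.Theory.

Local Open Scope ring_scope.

(* Directed multigraphs: distinct arrows may share both endpoints. *)
Record quiver := Quiver {
  node : finType;
  arrow : finType;
  source : arrow -> node;
  target : arrow -> node }.

Fixpoint is_walk (Q : quiver) (x y : node Q) (s : seq (arrow Q)) : bool :=
  if s is e :: s' then (source e == x) && is_walk (target e) y s' else x == y.

Definition num_walks (Q : quiver) (k : nat) (x y : node Q) : nat :=
  #|[set s : k.-tuple (arrow Q) | is_walk x y s]|.

(* Matrices are indexed by ordinals: the node x is row/column enum_rank x. *)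
Definition adjacency_mx (Q : quiver) : 'M[nat]_#|node Q| :=
  \matrix_(i, j) #|[set e : arrow Q |
    (source e == enum_val i) && (target e == enum_val j)]|.

Section Representations.

Variables (F : decFieldType) (gT : finGroupType) (G : {group gT}).

Definition repr_char (V : representation F G) (g : gT) : F := \tr (V g).

(* [W : DecSocleType V] ranges over the isotypic components of [V], of type   *)
(* [socle_repr W]; at most one of them has the type of a given irreducible U. *)
Definition multiplicity (U V : representation F G) : nat :=
  \sum_(W : DecSocleType V | `[< mx_rsim (socle_repr W) U >]) socle_mult W.

Definition irr_labelling (L : finType) (irr : L -> representation F G) : Prop :=
  [/\ forall l, mx_irreducible (irr l),
      forall l m, mx_rsim (irr l) (irr m) -> l = m
    & forall U : representation F G,
        mx_irreducible U -> exists l, mx_rsim U (irr l)].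

Definition tensor_repr (U V : representation F G) : representation F G :=
  Representation (prod_repr U V).

Definition mckay_quiver (L : finType) (irr : L -> representation F G)
    (V : representation F G) : quiver :=
  let a (p : L * L) := multiplicity (irr p.2) (tensor_repr (irr p.1) V) in
  @Quiver L {p : L * L & 'I_(a p)} (fun e => (tag e).1) (fun e => (tag e).2).

End Representations.

Definition class_labelling (gT : finGroupType) (G : {group gT}) (L : finType)
    (Cl : L -> {set gT}) : Prop :=
  injective Cl /\ [set Cl l | l : L] = classes G.

(* Main.v *)
(** Decomposing [irr x] tensored with [V] into irreducibles gives
    chi_x chi_V = \sum_y A_(x,y) chi_y pointwise on [G], hence by induction
    chi_x chi_V^k = \sum_y (A^k)_(x,y) chi_y. Pairing with chi_y and using the
    orthonormality of irreducible characters extracts the entry (A^k)_(x,y).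
    Orthogonality follows from Schur's lemma applied to the averaged matrices
    \sum_g rU(g) X rW(g^-1); conjugation is inversion on characters because
    [rG g] is diagonalizable with eigenvalues roots of unity. *)
Require Import Defs.
From HB Require Import structures.
From mathcomp Require Import all_boot all_order all_fingroup all_algebra.
From mathcomp Require Import mxrepresentation character.
From mathcomp Require Import separable cyclotomic classfun.
From mathcomp Require Import boolp reals complex.

Set Implicit Arguments.
Unset Strict Implicit.
Unset Printing Implicit Defensive.

Import GRing.Theory Num.Theory.

Local Open Scope ring_scope.

(** * Counting walks by powers of the adjacency matrix *)

Lemma num_walks0 (Q : quiver) (x y : node Q) : num_walks 0 x y = (x == y).
Proof.
rewrite /num_walks; case: eqP => [->|/eqP neq_xy].
  rewrite (_ : [set s | _] = [set [tuple]]) ?cards1 //.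
  by apply/setP=> s; rewrite !inE !tuple0 /= !eqxx.
apply/eqP; rewrite cards_eq0; apply/eqP/setP=> s.
by rewrite !inE tuple0 /= (negPf neq_xy).
Qed.

(** Walks are sorted by their first arrow, and the arrows leaving [x] by their target [z]. *)
Lemma num_walksS (Q : quiver) k (x y : node Q) :
  num_walks k.+1 x y =
  (\sum_z #|[set e : arrow Q | (source e == x) && (target e == z)]|
     * num_walks k z y)%N.
Proof.
rewrite /num_walks -sum1_card.
rewrite (partition_big (fun s => thead s) (fun e => source e == x)) /=.
  under [RHS]eq_bigr do rewrite -sum1_card big_distrl /=.
  under [RHS]eq_bigr do under eq_bigl do rewrite inE.
  rewrite [RHS](exchange_big_dep (fun e : arrow Q => source e == x)) /=.
    apply: eq_bigr => e xe; under [RHS]eq_bigl do rewrite xe eq_sym /=.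
    rewrite big_pred1_eq mul1n -sum1_card.
    rewrite (reindex_onto (fun s : k.-tuple _ => [tuple of e :: s])
               (fun s => [tuple of behead s])) /=.
      apply: eq_bigl => s; rewrite !inE /= xe theadE eqxx andbT.
      by rewrite (_ : [tuple of _] == s) ?andbT //; apply/eqP/val_inj.
    by move=> s /andP[_ /eqP <-]; rewrite [RHS]tuple_eta.
  by move=> z e _ /andP[].
by case/tupleP=> e s; rewrite inE theadE => /andP[].
Qed.

Lemma num_walks_adjacency_mx (Q : quiver) k (x y : node Q) :
  num_walks k x y = (adjacency_mx Q ^+ k) (enum_rank x) (enum_rank y).
Proof.
elim: k x => [|k IHk] x.
  by rewrite num_walks0 expr0 mxE (inj_eq enum_rank_inj) natn.
rewrite num_walksS exprS mxE [RHS](reindex enum_rank) /=; last first.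
  by apply: onW_bij; apply: enum_rank_bij.
by apply: eq_bigr => z _; rewrite IHk mxE !enum_rankK.
Qed.

(** * Traces of inverses of matrices of finite order *)

Lemma finite_order_diag (C : numClosedFieldType) n (A : 'M[C]_n) N :
    (0 < N)%N -> A ^+ N = 1 ->
  exists2 P, P \in unitmx & exists d, A = invmx P *m diag_mx d *m P.
Proof.
move=> N_gt0; case: n A => [|n] A AN.
  by exists 1%:M; [exact: unitmx1 | exists 0; rewrite [LHS]flatmx0 [RHS]flatmx0].
have [rs defXN] := closed_field_poly_normal ('X^N - 1 : {poly C}).
rewrite lead_coefDl ?size_polyXn ?lead_coefXn ?scale1r in defXN; last first.
  by rewrite size_polyN size_poly1 ltnS.
(* In characteristic 0, [N > 0] makes ['X^N - 1] separable. As [A] is a root of it, the minimal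
   polynomial of [A] has simple roots, whence diagonalizability. *)
have uniq_rs : uniq rs.
  rewrite -separable_prod_XsubC -defXN separable_Xn_sub_1 //.
  by rewrite pnatr_eq0 -lt0n.
have [|P Punit /similar_diagPex[d /(similarLR Punit) ->]] :=
  (diagonalizableP A).2.
  exists rs => //; rewrite -defXN; apply: mxminpoly_min.
  by rewrite rmorphB /= rmorphXn /= horner_mx_X rmorph1 AN subrr.
by exists P => //; exists d; rewrite conjVmx.
Qed.

Lemma mxtrace_finite_order_inv (C : numClosedFieldType) n (A B : 'M[C]_n) N :
  (0 < N)%N -> A ^+ N = 1 -> A *m B = 1%:M -> \tr B = (\tr A)^*.
Proof.
move=> N_gt0 AN AB1; have [P Pu [d defA]] := finite_order_diag N_gt0 AN.
have dN i : d 0 i ^+ N = 1.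
  have : diag_mx d ^+ N = 1.
    have -> : diag_mx d = P *m A *m invmx P.
      by rewrite defA !mulmxA mulmxV // mul1mx mulmxK.
    have conjX m : (P *m A *m invmx P) ^+ m = P *m A ^+ m *m invmx P.
      elim: m => [|m IHm]; first by rewrite !expr0 mulmx1 mulmxV.
      by rewrite !exprS IHm -![_ * _]/(_ *m _) !mulmxA mulmxKV.
    by rewrite conjX AN mulmx1 mulmxV.
  have diagX m : (diag_mx d ^+ m) i i = d 0 i ^+ m.
    elim: m => [|m IHm]; first by rewrite !expr0 mxE eqxx.
    by rewrite !exprS -IHm -[_ * _]/(_ *m _) mul_diag_mx mxE.
  by move/(congr1 (fun M : 'M_n => M i i)); rewrite diagX mxE eqxx.
(* It suffices that the right-hand side is also a right inverse of [A], since [A] cancels on the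
   left. *)
have -> : B = invmx P *m diag_mx (map_mx Num.conj d) *m P.
  apply: (can_inj (mulKmx (mulmx1_unit AB1).1)); rewrite AB1 {1}defA.
  rewrite !mulmxA mulmxK // -(mulmxA (invmx P)) mulmx_diag.
  rewrite (_ : diag_mx _ = 1%:M) ?mulmx1 ?mulVmx //.
  rewrite -diag_const_mx; congr diag_mx; apply/rowP=> i; rewrite !mxE.
  (* A nonnegative real whose [N]-th power is 1 equals 1, so each eigenvalue has norm 1. *)
  have /eqP := dN i; rewrite -normCK.
  move/eqP/(congr1 Num.norm); rewrite normrX normr1 => /eqP.
  by rewrite pexpr_eq1 // => /eqP ->; rewrite expr1n.
rewrite defA mxtrace_mulC mulKVmx // mxtrace_mulC mulKVmx //.
by rewrite !mxtrace_diag rmorph_sum; apply: eq_bigr => i _; rewrite mxE.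
Qed.

Lemma mxtrace_repr_inv (C : numClosedFieldType) (gT : finGroupType)
    (G : {group gT}) n (rG : mx_representation C G n) g :
  g \in G -> \tr (rG g^-1%g) = (\tr (rG g))^*.
Proof.
move=> Gg; apply: (mxtrace_finite_order_inv (order_gt0 g)).
  suff rGX m : rG g ^+ m = rG (g ^+ m)%g by rewrite rGX expg_order repr_mx1.
  elim: m => [|m IHm]; first by rewrite expr0 repr_mx1.
  by rewrite exprS expgS repr_mxM ?groupX // -IHm.
by rewrite -repr_mxM ?groupV // mulgV repr_mx1.
Qed.

(** * Schur's lemma and orthogonality of irreducible characters *)

Section Averaging.

Variables (F : fieldType) (gT : finGroupType) (G : {group gT}).
Variables (m n : nat).
Variables (rU : mx_representation F G m) (rW : mx_representation F G n).

Definition average_mx (X : 'M[F]_(m, n)) : 'M[F]_(m, n) :=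
  \sum_(g in G) rU g *m X *m rW g^-1%g.

Lemma average_mx_hom X h :
  h \in G -> rU h *m average_mx X = average_mx X *m rW h.
Proof.
move=> Gh; rewrite /average_mx mulmx_sumr mulmx_suml.
rewrite [RHS](reindex_inj (mulgI h)) /=.
apply: eq_big => [g|g Gg]; first by rewrite groupMl.
rewrite invMg !repr_mxM ?groupV // !mulmxA -!mulmxA -repr_mxM ?groupV //.
by rewrite mulVg repr_mx1 mulmx1.
Qed.

(** The [(i, j)] entry of [rU g *m delta_mx i j *m rW g^-1] is the product of the diagonal entries
    [rU g i i] and [rW g^-1 j j]. *)
Lemma sum_mxtrace_average :
  \sum_(g in G) \tr (rU g) * \tr (rW g^-1%g) =
  \sum_i \sum_j average_mx (delta_mx i j) i j.
Proof.
under [RHS]eq_bigr do under eq_bigr do rewrite summxE.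
under [RHS]eq_bigr do rewrite exchange_big /=.
rewrite [RHS]exchange_big /=; apply: eq_bigr => g _.
rewrite big_distrl; apply: eq_bigr => i _; rewrite big_distrr.
apply: eq_bigr => j _ /=.
rewrite -mulmxA mxE (bigD1 i) //= big1 ?addr0 => [|k neq_ki].
  rewrite mxE (bigD1 j) //= big1 ?addr0 => [|k neq_kj].
    by rewrite mxE !eqxx mul1r.
  by rewrite mxE (negPf neq_kj) andbF mul0r.
by rewrite mxE big1 ?mulr0 // => l _; rewrite mxE (negPf neq_ki) mul0r.
Qed.

Hypotheses (irrU : mx_irreducible rU) (irrW : mx_irreducible rW).

(** Schur's lemma: the kernel and the row space of an intertwiner are submodules, so a nonzero [f]
    is injective and surjective. *)
Lemma irr_hom_rsim (f : 'M[F]_(m, n)) :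
  (forall h, h \in G -> rU h *m f = f *m rW h) -> f != 0 -> mx_rsim rU rW.
Proof.
move=> homf nzf.
have [m_gt0 minU] := (mx_irrP _).1 irrU; have [n_gt0 minW] := (mx_irrP _).1 irrW.
have freef : row_free f.
  rewrite -kermx_eq0; apply: contraNT nzf => /minU fullK.
  have {}fullK : row_full (kermx f).
    apply: fullK; apply/mxmoduleP=> h Gh; apply/sub_kermxP.
    by rewrite -mulmxA homf // mulmxA mulmx_ker mul0mx.
  by rewrite -[f]mul1mx; apply/eqP/sub_kermxP; rewrite sub1mx.
have fullf : row_full <<f>>%MS.
  apply: minW; last by rewrite -mxrank_eq0 genmxE mxrank_eq0.
  rewrite (eqmx_module _ (genmxE _)); apply/mxmoduleP=> h Gh.
  by rewrite -homf // submxMl.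
(* The equality [m = n] demanded by [mx_rsim] holds because both are the rank of [f]. *)
exists f => //; rewrite -(eqP fullf) genmxE; exact/esym/eqP.
Qed.

Lemma irr_orthogonal :
  ~ mx_rsim rU rW -> \sum_(g in G) \tr (rU g) * \tr (rW g^-1%g) = 0.
Proof.
move=> nsimUW; rewrite sum_mxtrace_average.
apply: big1 => i _; apply: big1 => j _.
have [-> | nz] := eqVneq (average_mx (delta_mx i j)) 0; first by rewrite mxE.
case: nsimUW; apply: irr_hom_rsim nz; exact: average_mx_hom.
Qed.

End Averaging.

(** By Schur's lemma over a closed field, each averaged [delta_mx i j] is scalar. Only the [n]
    diagonal positions contribute, each giving [#|G| / n]. *)
Lemma irr_normal (F : numClosedFieldType) (gT : finGroupType) (G : {group gT}) n
    (rG : mx_representation F G n) :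
  mx_irreducible rG ->
  \sum_(g in G) \tr (rG g) * \tr (rG g^-1%g) = #|G|%:R.
Proof.
move=> irrG; have [n_gt0 _] := (mx_irrP rG).1 irrG.
have absG := group_closure_closed_field irrG.
have nzn : n%:R != 0 :> F by rewrite pnatr_eq0 -lt0n.
have avgE i j :
    average_mx rG rG (delta_mx i j) = (#|G|%:R * (i == j)%:R / n%:R)%:M.
  set T := average_mx _ _ _.
  have [|a defT] := is_scalar_mxP
      (mx_abs_irr_cent_scalar absG _ : is_scalar_mx T).
    by apply/centgmxP=> h Gh; rewrite average_mx_hom.
  (* The scalar [a] is found by taking traces: [n * a] is [#|G|] times the trace of
     [delta_mx i j]. *)
  rewrite defT; congr (_%:M); apply: (canRL (mulfK nzn)).
  rewrite (mulr_natr a) -mxtrace_scalar -defT /T /average_mx raddf_sum /=.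
  rewrite mulr_natl -sumr_const; apply: eq_bigr => g Gg.
  rewrite mxtrace_mulC mulmxA -repr_mxM ?groupV // mulVg repr_mx1 mul1mx.
  rewrite /mxtrace (bigD1 i) //= big1 ?addr0 => [|k nki]; rewrite mxE ?eqxx //.
  by rewrite (negPf nki).
rewrite sum_mxtrace_average.
rewrite (eq_bigr (fun=> #|G|%:R / n%:R)) => [|i _].
  by rewrite sumr_const card_ord -[LHS]mulr_natr divfK.
rewrite (bigD1 i) //= big1 ?addr0 => [|j nji].
  by rewrite avgE mxE !eqxx mulr1.
by rewrite avgE mxE eq_sym (negPf nji).
Qed.

(** * Tensoring with [V] and the McKay adjacency matrix *)

Section McKay.

Variables (C : numClosedFieldType) (gT : finGroupType) (G : {group gT}).
Variables (L : finType) (irr : L -> representation C G).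
Hypothesis irrP : irr_labelling irr.

(** By Maschke's theorem [U] is its own socle, so its trace is the sum over isotypic components. *)
Lemma repr_char_multiplicity (U : representation C G) g : g \in G ->
  repr_char U g = \sum_l (multiplicity (irr l) U)%:R * repr_char (irr l) g.
Proof.
move=> Gg; have [_ irr_inj irr_surj] := irrP.
have soc1 : Socle (DecSocleType U) = 1%:M.
  apply/reducible_Socle1/mx_Maschke_pchar.
  by rewrite /pgroup.pgroup pcharf'_nat pnatr_eq0 -lt0n.
rewrite {1}/repr_char -(mxtrace_submod1 (Socle_module (DecSocleType U))).
2,3: by rewrite ?soc1.
rewrite mxtrace_Socle // /multiplicity.
under [RHS]eq_bigr do rewrite natr_sum big_distrl /=.
rewrite [RHS](exchange_big_dep predT) //=; apply: eq_bigr => W _.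
(* Each component has the type of exactly one label [l], so after the exchange the inner sum has one
   term. *)
have [l simWl] := irr_surj (Representation (socle_repr W)) (socle_irr W).
rewrite (big_pred1 l) => [|l'] /=.
  by rewrite mulr_natl /repr_char (mxtrace_rsim simWl).
apply/asboolP/eqP => [simWl' | -> //].
by apply: irr_inj; apply: mx_rsim_trans (mx_rsim_sym simWl') simWl.
Qed.

Lemma irr_orthonormal l l' :
  \sum_(g in G) repr_char (irr l) g * (repr_char (irr l') g)^* =
  #|G|%:R *+ (l == l').
Proof.
have [irr_irr irr_inj _] := irrP.
under eq_bigr => g Gg do rewrite -mxtrace_repr_inv //.
have [->|neq_ll'] := eqVneq l l'; first exact: irr_normal.
apply: irr_orthogonal => // sim_ll'.
by case/eqP: neq_ll'; apply: irr_inj.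
Qed.

Variable V : representation C G.
Let A := adjacency_mx (mckay_quiver irr V).

(** The arrows from [x] to [y] are the dependent pairs with tag [(x, y)]; [Tagged] identifies them
    with an ordinal type of the right size. *)
Lemma adjacency_mckay (x y : L) :
  A (enum_rank x) (enum_rank y) = multiplicity (irr y) (tensor_repr (irr x) V).
Proof.
rewrite mxE !enum_rankK /=; set n := multiplicity _ _.
rewrite -[RHS]card_ord -(@card_imset _ _ (Tagged (fun p : L * L =>
  'I_(multiplicity (irr p.2) (tensor_repr (irr p.1) V))) (i := (x, y)))).
  apply: eq_card => -[[x' y'] i]; rewrite inE /=.
  apply/andP/imsetP => [[/eqP ? /eqP ?]|[j _ /(congr1 tag) [-> ->]] //].
  by subst x' y'; exists i.
by move=> i j /eqP; rewrite eq_Tagged => /eqP.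
Qed.

Lemma repr_char_adjacency_exp k (x : L) g : g \in G ->
  repr_char (irr x) g * repr_char V g ^+ k =
  \sum_y ((A ^+ k) (enum_rank x) (enum_rank y))%:R * repr_char (irr y) g.
Proof.
move=> Gg; elim: k x => [|k IHk] x.
  rewrite expr0 mulr1 expr0 (bigD1 x) //= big1 ?addr0 => [|y nyx].
    by rewrite mxE eqxx mul1r.
  by rewrite mxE (inj_eq enum_rank_inj) eq_sym (negPf nyx) mul0r.
(* One factor of the character of [V] is absorbed into the tensor product with [irr x]; the
   induction hypothesis is then applied at each constituent. *)
rewrite exprS mulrA -mxtrace_prod.
rewrite -[\tr _]/(repr_char (tensor_repr (irr x) V) g) repr_char_multiplicity //.
rewrite big_distrl /=; under eq_bigr do rewrite -mulrA IHk big_distrr /=.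
rewrite exchange_big; apply: eq_bigr => y _ /=.
rewrite exprS mxE (reindex enum_rank) /=; last first.
  by apply: onW_bij; apply: enum_rank_bij.
rewrite natr_sum big_distrl; apply: eq_bigr => z _ /=.
by rewrite mulrA -natrM adjacency_mckay.
Qed.

Lemma adjacency_exp_sum k (x y : L) :
  ((A ^+ k) (enum_rank x) (enum_rank y))%:R =
  #|G|%:R^-1 * \sum_(g in G) repr_char (irr x) g * repr_char V g ^+ k
                 * (repr_char (irr y) g)^*.
Proof.
have nzG : #|G|%:R != 0 :> C by rewrite pnatr_eq0 -lt0n.
apply: (canRL (mulKf nzG)).
under eq_bigr => g Gg do rewrite repr_char_adjacency_exp // big_distrl /=.
(* Orthogonality leaves only the term at [y], weighted by [#|G|]. *)
rewrite exchange_big (bigD1 y) //= [X in _ + X]big1 ?addr0 => [|z nzy].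
  under eq_bigr do rewrite -mulrA.
  by rewrite -big_distrr /= irr_orthonormal eqxx mulrC.
under eq_bigr do rewrite -mulrA.
by rewrite -big_distrr /= irr_orthonormal (negPf nzy) mulr0.
Qed.

End McKay.

(** * From sums over the group to sums over conjugacy classes *)

Lemma repr_charJ (F : decFieldType) (gT : finGroupType) (G : {group gT})
    (V : representation F G) :
  {in G &, forall g h, repr_char V (g ^ h)%g = repr_char V g}.
Proof.
move=> g h Gg Gh; rewrite /repr_char conjgE !repr_mxM ?groupM ?groupV //.
by rewrite mxtrace_mulC -mulmxA -repr_mxM ?groupV // mulgV repr_mx1 mulmx1.
Qed.

Lemma sum_class_labelling (R : nzRingType) (gT : finGroupType)
    (G : {group gT}) (L : finType) (Cl : L -> {set gT}) (c : L -> gT)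
    (f : gT -> R) :
    class_labelling G Cl -> (forall l, c l \in Cl l) ->
    {in G &, forall g h, f (g ^ h)%g = f g} ->
  \sum_(g in G) f g = \sum_l #|Cl l|%:R * f (c l).
Proof.
move=> [Cl_inj ClE] Cl_c fJ; rewrite (sum_by_classes fJ) -ClE.
rewrite big_imset /=; last by move=> l l' _ _ /Cl_inj.
apply: eq_bigr => l _; congr (_ * _).
have /imsetP[g Gg defCl] : Cl l \in classes G by rewrite -ClE imset_f.
have /imsetP[h Gh ->] : c l \in (g ^: G)%g by rewrite -defCl.
(* Both [c l] and the canonical representative used by [sum_by_classes] are conjugates of [g], so
   [f] agrees on them. *)
by rewrite defCl fJ //; have [h' Gh' ->] := repr_class G g; rewrite fJ.
Qed.

Theorem theorem1p5 (R : realType) (gT : finGroupType) (G : {group gT})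
    (Lambda : finType)
    (irr : Lambda -> representation (complex R) G) (irrP : irr_labelling irr)
    (Cl : Lambda -> {set gT}) (ClP : class_labelling G Cl)
    (c : Lambda -> gT) (cP : forall mu, c mu \in Cl mu)
    (V : representation (complex R) G) (nu lambda : Lambda) (k : nat) :
  let Q := mckay_quiver irr V in
  let A := adjacency_mx Q in
  let chi := fun l => repr_char (irr l) in
  [/\ @num_walks Q k nu lambda = (A ^+ k) (enum_rank nu) (enum_rank lambda),
      ((A ^+ k) (enum_rank nu) (enum_rank lambda))%:R
      = #|G|%:R^-1 * \sum_(mu : Lambda) #|Cl mu|%:R * chi nu (c mu)
          * repr_char V (c mu) ^+ k * (chi lambda (c mu))^*
    & ((A ^+ k) (enum_rank nu) (enum_rank lambda))%:R
      = #|G|%:R^-1 * \sum_(g in G) chi nu g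
          * repr_char V g ^+ k * (chi lambda g)^* ].
Proof.
move=> Q A chi; split; first exact: num_walks_adjacency_mx.
  rewrite (adjacency_exp_sum irrP); congr (_ * _).
  rewrite (sum_class_labelling ClP cP) => [|g h Gg Gh]; last by rewrite !repr_charJ.
  by apply: eq_bigr => mu _; rewrite !mulrA.
exact: adjacency_exp_sum irrP _ _ _ _.
Qed.
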